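(* Let $(M,\tilde\varphi,\xi,\eta,\tilde g)$ be a paracontact metric $(\tilde\kappa,\tilde\mu)$-manifold with $\tilde\kappa>-1$, and set $\tilde\lambda=\sqrt{1+\tilde\kappa}$; assume the index of $\mathcal D_{\tilde h}(\pm\tilde\lambda)$ is constant on $M$. Then the eigendistributions $\mathcal D_{\tilde h}(\tilde\lambda)$ and $\mathcal D_{\tilde h}(-\tilde\lambda)$ of $\tilde h$ are integrable and define two totally geodesic Legendre foliations of $M$. Moreover, for any $X\in\Gamma(\mathcal D_{\tilde h}(\tilde\lambda))$ and $Y\in\Gamma(\mathcal D_{\tilde h}(-\tilde\lambda))$, $\tilde\nabla_XY$ has no component along $\mathcal D_{\tilde h}(\tilde\lambda)$ and $\tilde\nabla_YX$ has no component along $\mathcal D_{\tilde h}(-\tilde\lambda)$, with respect to the decomposition $TM=\mathcal D_{\tilde h}(\tilde\lambda)\oplus\mathcal D_{\tilde h}(-\tilde\lambda)\oplus\mathbb R\xi$.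
   Context: Conventions: $2d\eta(X,Y)=X(\eta(Y))-Y(\eta(X))-\eta([X,Y])$; $R_{XY}Z=\nabla_X\nabla_YZ-\nabla_Y\nabla_XZ-\nabla_{[X,Y]}Z$; $\tilde\nabla$ is the Levi-Civita connection of $\tilde g$. An almost paracontact structure on a $(2n+1)$-dimensional manifold $M$ is $(\tilde\varphi,\xi,\eta)$, with $\tilde\varphi$ a $(1,1)$-tensor field, $\xi$ a vector field, $\eta$ a 1-form, such that $\eta(\xi)=1$, $\tilde\varphi^2=I-\eta\otimes\xi$ and the $\pm1$-eigendistributions of $\tilde\varphi$ on $\mathcal D=\ker\eta$ both have dimension $n$. With a pseudo-Riemannian metric $\tilde g$ satisfying $\tilde g(\tilde\varphi X,\tilde\varphi Y)=-\tilde g(X,Y)+\eta(X)\eta(Y)$ and $d\eta(X,Y)=\tilde g(X,\tilde\varphi Y)$ it is a paracontact metric structure. Put $\tilde h=\frac12\mathcal L_\xi\tilde\varphi$. A paracontact metric $(\tilde\kappa,\tilde\mu)$-manifold ($\tilde\kappa,\tilde\mu$ real constants) is a paracontact metric manifold whose curvature tensor satisfies $\tilde R_{XY}\xi=\tilde\kappa(\eta(Y)X-\eta(X)Y)+\tilde\mu(\eta(Y)\tilde hX-\eta(X)\tilde hY)$ for all vector fields $X,Y$. When $\tilde\kappa>-1$, $\tilde h$ is diagonalizable with eigenvalues $0$ (eigenspace $\mathbb R\xi$) and $\pm\tilde\lambda$ (each of multiplicity $n$); $\mathcal D_{\tilde h}(\pm\tilde\lambda)$ denote the $\pm\tilde\lambda$-eigendistributions,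 and the index is that of the restriction of $\tilde g$. A Legendre foliation of $(M,\eta)$ is an $n$-dimensional integrable subbundle $L$ of $\mathcal D$ with $d\eta(X,X')=0$ for all $X,X'\in\Gamma(L)$. It is totally geodesic if $\tilde\nabla_XX'\in\Gamma(L)$ for all $X,X'\in\Gamma(L)$. *)

(* Defs.v *)
From HB Require Import structures.
From mathcomp Require Import all_boot all_order all_algebra.
From mathcomp Require Import all_classical all_reals all_analysis.
From mathcomp Require Import ring.
Import Order.TTheory GRing.Theory Num.Theory.
Import numFieldNormedType.Exports.

Set Implicit Arguments.
Unset Strict Implicit.
Unset Printing Implicit Defensive.

Local Open Scope classical_set_scope.
Local Open Scope ring_scope.

Section Euclidean.
Variables (R : realType) (m : nat).
Implicit Types (U : set 'rV[R]_m) (f g : 'rV[R]_m -> R).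

Definition basis_vector (i : 'I_m) : 'rV[R]_m := delta_mx 0 i.

(* [f] is of class C^k on [U]; only meant for open [U]. *)
Fixpoint class_C (k : nat) U f : Prop :=
  (forall x, U x -> {for x, continuous f}) /\
  if k is k'.+1 then forall i,
    (forall x, U x -> derivable f x (basis_vector i)) /\
    class_C k' U (fun x => 'D_(basis_vector i) f x)
  else True.

Definition smooth_on U f := forall k, class_C k U f.

Lemma class_C_continuous k U f : class_C k U f ->
  forall x, U x -> {for x, continuous f}.
Proof. by case: k => [|k] []. Qed.

Lemma class_CW k U f : class_C k.+1 U f -> class_C k U f.
Proof.
elim: k f => [f [cf _]|k IH f [cf df]]; first by split.
by split=> // i; have [? ?] := df i; split=> //; apply: IH.
Qed.

Lemma eq_class_C k U f g : open U -> (forall x, U x -> f x = g x) ->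
  class_C k U f -> class_C k U g.
Proof.
move=> oU.
have near_eq (f1 g1 : 'rV[R]_m -> R) : (forall x, U x -> f1 x = g1 x) ->
    forall x, U x -> \forall y \near x, f1 y = g1 y.
  move=> fg x Ux; near=> y; apply: fg; near: y.
  exact: open_nbhs_nbhs.
have continuous_eq (f1 g1 : 'rV[R]_m -> R) : (forall x, U x -> f1 x = g1 x) ->
    forall x, U x -> {for x, continuous f1} -> {for x, continuous g1}.
  move=> fg x Ux cf; suff: f1 y @[y --> x] --> g1 x.
    apply: cvg_trans; apply: (@near_eq_cvg _ _ (nbhs x)).
    exact: (near_eq _ _ fg x Ux).
  by rewrite -(fg x Ux); exact: cf.
elim: k f g => [|k IH] f g fg [cf df]; split=> //=.
- by move=> x Ux; apply: continuous_eq fg x Ux (cf x Ux).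
- by move=> x Ux; apply: continuous_eq fg x Ux (cf x Ux).
move=> i; have [dfi Cfi] := df i; split.
  move=> x Ux; apply: near_eq_derivable (dfi x Ux).
  exact: (near_eq _ _ fg x Ux).
apply: IH Cfi => x Ux; apply: near_eq_derive.
exact: (near_eq _ _ fg x Ux).
Unshelve. all: by end_near. Qed.

Lemma class_C_cst k U (c : R) : open U -> class_C k U (cst c).
Proof.
move=> oU; have cc (a : R) x : {for x, continuous (cst a : 'rV[R]_m -> R)}.
  exact: cst_continuous.
elim: k c => [|k IH] c; split=> //; try by move=> x _; apply: cc.
move=> i; split=> [x _|]; first exact: derivable_cst.
apply: (eq_class_C oU _ (IH 0)) => x _.
by rewrite derive_cst.
Qed.

Lemma class_CD k U f g : open U -> class_C k U f -> class_C k U g ->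
  class_C k U (fun x => f x + g x).
Proof.
move=> oU; elim: k f g => [|k IH] f g [cf df] [cg dg]; split=> //.
- by move=> x Ux; apply: continuousD; [apply: cf|apply: cg].
- by move=> x Ux; apply: continuousD; [apply: cf|apply: cg].
move=> i; have [dfi Cfi] := df i; have [dgi Cgi] := dg i; split.
  by move=> x Ux; apply: derivableD; [apply: dfi|apply: dgi].
apply: (eq_class_C oU _ (IH _ _ Cfi Cgi)) => x Ux.
by rewrite -deriveD; [|apply: dfi|apply: dgi].
Qed.

Lemma class_CM k U f g : open U -> class_C k U f -> class_C k U g ->
  class_C k U (fun x => f x * g x).
Proof.
move=> oU; elim: k f g => [|k IH] f g Cf Cg.
  split=> // x Ux; apply: continuousM; first exact: (class_C_continuous Cf).
  exact: (class_C_continuous Cg).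
have [cf df] := Cf; have [cg dg] := Cg; split.
  by move=> x Ux; apply: continuousM; [apply: cf|apply: cg].
move=> i; have [dfi Cfi] := df i; have [dgi Cgi] := dg i; split.
  by move=> x Ux; apply: derivableM; [apply: dfi|apply: dgi].
have CD := class_CD oU (IH _ _ (class_CW Cf) Cgi) (IH _ _ (class_CW Cg) Cfi).
apply: (eq_class_C oU _ CD) => x Ux.
by rewrite -deriveM; [|apply: dfi|apply: dgi].
Qed.

End Euclidean.

(* [chart_inv] is only relevant on the image of the domain. *)
Record chart (R : realType) (m : nat) (T : topologicalType) := Chart {
  chart_dom : set T;
  chart_map : T -> 'rV[R]_m;
  chart_inv : 'rV[R]_m -> T;
  chart_dom_open : open chart_dom;
  chart_im_open : open (chart_map @` chart_dom);
  chart_mapK : forall x, chart_dom x -> chart_inv (chart_map x) = x;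
  chart_map_continuous : forall x, chart_dom x -> {for x, continuous chart_map};
  chart_inv_continuous : forall y, (chart_map @` chart_dom) y ->
    {for y, continuous chart_inv} }.

(* The atlas is not required to be maximal. *)
Record smooth_manifold (R : realType) (m : nat) := SmoothManifold {
  carrier :> topologicalType;
  manifold_hausdorff : hausdorff_space carrier;
  manifold_second_countable : @second_countable carrier;
  atlas : set (chart R m carrier);
  atlas_cover : forall x, exists2 c, atlas c & chart_dom c x;
  atlas_compatible : forall c d, atlas c -> atlas d -> forall i,
    smooth_on (chart_map c @` (chart_dom c `&` chart_dom d))
      (fun y => chart_map d (chart_inv c y) 0 i) }.

Section SmoothFunctions.
Variables (R : realType) (m : nat) (M : smooth_manifold R m).

Definition is_smooth (f : M -> R) := forall c, atlas c ->
  smooth_on (chart_map c @` chart_dom c) (f \o chart_inv c).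

Definition smooth_pred : {pred M -> R} := mem [set f | is_smooth f].

Lemma smooth_subring : subring_closed smooth_pred.
Proof.
have sM f g : is_smooth f -> is_smooth g -> is_smooth (f * g).
  move=> sf sg c Ac k.
  have := class_CM (@chart_im_open _ _ _ c) (sf c Ac k) (sg c Ac k).
  by apply: eq_class_C => //; exact: chart_im_open.
have sC a : is_smooth (fun=> a).
  by move=> c Ac k; apply: class_C_cst; apply: chart_im_open.
split=> [|f g|f g]; rewrite ?inE /=; first exact: (sC 1).
- move=> sf sg c Ac k.
  have := class_CD (@chart_im_open _ _ _ c) (sf c Ac k)
    (class_CM (@chart_im_open _ _ _ c) (sC (-1) c Ac k) (sg c Ac k)).
  apply: eq_class_C => [|x _ /=]; first exact: chart_im_open.
  by rewrite mulN1r.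
- exact: sM.
Qed.

Record smooth_fun := SmoothFun {
  smooth_fun_val :> M -> R;
  smooth_funP : smooth_fun_val \in smooth_pred }.

HB.instance Definition _ := [isSub for smooth_fun_val].
HB.instance Definition _ := [Choice of smooth_fun by <:].
HB.instance Definition _ := GRing.SubChoice_isSubPzRing.Build (M -> R) smooth_pred
  smooth_fun smooth_subring.
HB.instance Definition _ := GRing.SubPzRing_isSubComPzRing.Build (M -> R)
  smooth_pred smooth_fun.

Lemma smooth_cst_subproof (a : R) : (fun=> a : R) \in smooth_pred.
Proof.
by rewrite inE => c Ac k; apply: class_C_cst; apply: chart_im_open.
Qed.

Definition smooth_cst (a : R) := SmoothFun (smooth_cst_subproof a).

End SmoothFunctions.

Notation "''C^oo' ( M )" := (smooth_fun M) (format "''C^oo' ( M )").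
Notation "a %:S" := (smooth_cst _ a)
  (at level 1, format "a %:S").

Section VectorFields.
Variables (R : realType) (m : nat) (M : smooth_manifold R m).

(* Smooth vector fields are the R-linear derivations of C^oo(M). *)
Definition is_derivation (X : 'C^oo(M) -> 'C^oo(M)^o) :=
  [/\ forall f g, X (f + g) = X f + X g,
      forall (a : R) f, X (a%:S * f) = a%:S * X f &
      forall f g, X (f * g) = f * X g + g * X f].

Definition derivation_pred : {pred 'C^oo(M) -> 'C^oo(M)^o} :=
  mem [set X | is_derivation X].

Lemma derivation_submod : submod_closed derivation_pred.
Proof.
split.
  have E f : (0 : 'C^oo(M) -> 'C^oo(M)^o) f = 0 by [].
  by rewrite inE; split=> *; rewrite !E ?mulr0 ?addr0.
move=> h X Y; rewrite !inE => -[XD XZ XM] [YD YZ YM].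
have E f : (h *: X + Y) f = h * X f + Y f by [].
split=> *; rewrite !E ?XD ?YD ?XZ ?YZ ?XM ?YM; ring.
Qed.

HB.instance Definition _ := GRing.isSubmodClosed.Build 'C^oo(M)
  ('C^oo(M) -> 'C^oo(M)^o) derivation_pred derivation_submod.

Record vector_field := VectorField {
  vector_field_val :> 'C^oo(M) -> 'C^oo(M)^o;
  vector_fieldP : vector_field_val \in derivation_pred }.

HB.instance Definition _ := [isSub for vector_field_val].
HB.instance Definition _ := [Choice of vector_field by <:].
HB.instance Definition _ := [SubChoice_isSubZmodule of vector_field by <:].
HB.instance Definition _ := [SubZmodule_isSubLmodule of vector_field by <:].

Lemma lie_bracket_subproof (X Y : vector_field) :
  (fun f => X (Y f) - Y (X f)) \in derivation_pred.
Proof.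
have := vector_fieldP X; rewrite inE => -[XD XZ XM].
have := vector_fieldP Y; rewrite inE => -[YD YZ YM].
rewrite inE; split=> *; rewrite ?(XD, YD, XZ, YZ, XM, YM); ring.
Qed.

Definition lie_bracket (X Y : vector_field) :=
  VectorField (lie_bracket_subproof X Y).

End VectorFields.

Notation "[< X , Y >]" := (lie_bracket X Y) (format "[<  X ,  Y  >]").

Section Distributions.
Variables (R : realType) (m : nat) (M : smooth_manifold R m).
Implicit Types (X Y Z : vector_field M) (p : M).

(* A tangent vector at [p] is represented by a derivation f |-> v(f) at [p].
   By the existence of bump functions on [M], T_pM is exactly the set of the
   values at [p] of the global vector fields, and conditions on sections over
   open sets reduce to conditions on global sections. *)
Definition value_at X p : 'C^oo(M) -> R := fun f => (X f : 'C^oo(M)) p.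

Definition tangent_distribution := M -> set ('C^oo(M) -> R).

Definition sections (L : tangent_distribution) : set (vector_field M) :=
  [set X | forall p, L p (value_at X p)].

Definition has_dim (V : lmodType R) (A : set V) (k : nat) :=
  exists e : 'I_k -> V,
    (forall c : 'I_k -> R, \sum_i c i *: e i = 0 -> forall i, c i = 0) /\
    A = [set \sum_i c i *: e i | c in [set: 'I_k -> R]].

Definition subbundle (k : nat) (L : tangent_distribution) := forall p,
  has_dim (L p) k /\
  forall v, L p v -> exists2 X, sections L X & value_at X p = v.

(* In the sense of Frobenius. *)
Definition integrable_distribution (L : tangent_distribution) := forall X Y,
  sections L X -> sections L Y -> sections L [< X, Y >].

Definition kernel_distribution (eta : vector_field M -> 'C^oo(M)) :
    tangent_distribution :=
  fun p => [set value_at X p | X in [set X | eta X p = 0]].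

Definition eigendistribution (T : vector_field M -> vector_field M) (a : R) :
    tangent_distribution :=
  fun p => [set value_at X p |
            X in [set X | value_at (T X) p = a *: value_at X p]].

(* The set of components along [L1] of [Z] in TM = L1 + L2 + R xi is {0}. *)
Definition no_component (L1 L2 : tangent_distribution) (xi Z : vector_field M) :=
  [set A | sections L1 A /\ exists (B : vector_field M) (f : 'C^oo(M)),
             sections L2 B /\ Z = A + B + f *: xi] = [set 0].

End Distributions.

Section Geometry.
Variables (R : realType) (m : nat) (M : smooth_manifold R m).
Implicit Types (X Y Z xi : vector_field M) (p : M) (L : tangent_distribution M).
Implicit Types (phi : {linear vector_field M -> vector_field M}).
Implicit Types (eta : {linear vector_field M -> 'C^oo(M)^o}).
Implicit Types (g : vector_field M -> vector_field M -> 'C^oo(M)).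
Implicit Types (nabla : vector_field M -> vector_field M -> vector_field M).

(* The direct implication in [metric_nondegenerate] says that g is given by
   bilinear forms on the tangent spaces; it holds for every C^oo(M)-bilinear g. *)
Record pseudo_riemannian g : Prop := {
  metric_linear : forall X, linear (g X : vector_field M -> 'C^oo(M)^o);
  metric_sym : forall X Y, g X Y = g Y X;
  metric_nondegenerate : forall X p,
    value_at X p = 0 <-> forall Y, g X Y p = 0 }.

(* [k] is the largest dimension of a subspace of [L p] on which g is negative
   definite. *)
Definition has_index g L p (k : nat) :=
  let negdef j := exists e : 'I_j -> vector_field M,
    (forall i, L p (value_at (e i) p)) /\
    forall c : 'I_j -> R, (exists i, c i != 0) ->
      \sum_i \sum_i' c i * c i' * g (e i) (e i') p < 0 in
  negdef k /\ forall j, negdef j -> (j <= k)%N.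

Record levi_civita g nabla : Prop := {
  nablaDl : forall X Y Z, nabla (X + Y) Z = nabla X Z + nabla Y Z;
  nablaZl : forall (f : 'C^oo(M)) X Y, nabla (f *: X) Y = f *: nabla X Y;
  nablaDr : forall X Y Z, nabla X (Y + Z) = nabla X Y + nabla X Z;
  nablaZr : forall X (f : 'C^oo(M)) Y,
    nabla X (f *: Y) = (X f : 'C^oo(M)) *: Y + f *: nabla X Y;
  nabla_torsion_free : forall X Y, nabla X Y - nabla Y X = [< X, Y >];
  nabla_metric : forall X Y Z, X (g Y Z) = g (nabla X Y) Z + g Y (nabla X Z) }.

Definition curvature nabla X Y Z :=
  nabla X (nabla Y Z) - nabla Y (nabla X Z) - nabla [< X, Y >] Z.

(* Normalized by 2 d eta(X,Y) = X(eta(Y)) - Y(eta(X)) - eta([X,Y]). *)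
Definition exterior_derivative eta X Y : 'C^oo(M) :=
  (2^-1)%:S * (X (eta Y) - Y (eta X) - eta [< X, Y >]).

Definition lie_derivative xi phi X := [< xi, phi X >] - phi [< xi, X >].

Definition tensor_h phi xi X := (2^-1)%:S *: lie_derivative xi phi X.

Record almost_paracontact (n : nat) phi xi eta : Prop := {
  eta_xi : eta xi = 1 :> 'C^oo(M);
  phi_squared : forall X, phi (phi X) = X - (eta X : 'C^oo(M)) *: xi;
  phi_rank_pos : forall p,
    has_dim (kernel_distribution eta p `&` eigendistribution phi 1 p) n;
  phi_rank_neg : forall p,
    has_dim (kernel_distribution eta p `&` eigendistribution phi (-1) p) n }.

Record paracontact_metric (n : nat) phi xi eta g : Prop := {
  paracontact_almost : almost_paracontact n phi xi eta;
  paracontact_riemannian : pseudo_riemannian g;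
  paracontact_compatible : forall X Y,
    g (phi X) (phi Y) = - g X Y + eta X * eta Y;
  paracontact_d_eta : forall X Y, exterior_derivative eta X Y = g X (phi Y) }.

Definition nullity_condition phi xi eta nabla (kappa mu : R) := forall X Y,
  curvature nabla X Y xi =
    kappa%:S *: ((eta Y : 'C^oo(M)) *: X - (eta X : 'C^oo(M)) *: Y) +
    mu%:S *: ((eta Y : 'C^oo(M)) *: tensor_h phi xi X -
              (eta X : 'C^oo(M)) *: tensor_h phi xi Y).

Definition legendre_foliation (n : nat) eta L :=
  [/\ subbundle n L,
      forall p, L p `<=` kernel_distribution eta p,
      integrable_distribution L &
      forall X Y, sections L X -> sections L Y -> exterior_derivative eta X Y = 0].

Definition totally_geodesic nabla L := forall X Y,
  sections L X -> sections L Y -> sections L (nabla X Y).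

End Geometry.

(* Main.v *)
Require Import Defs.
From HB Require Import structures.
From mathcomp Require Import all_boot all_order all_algebra.
From mathcomp Require Import all_classical all_reals all_analysis.
From mathcomp Require Import ring lra.
Import Order.TTheory GRing.Theory Num.Theory.
Import numFieldNormedType.Exports.

(** Let D(a) be the a-eigendistribution of h, for a = l or - l, where l is a
    square root of 1 + kappa, positive or negative; l is not 0.

    The first step is the pointwise algebra of h. The field xi preserves
    eta, hence d eta, and differentiating g(X, phi Y) = d eta(X, Y) along xi
    shows that h is symmetric for g ([h_sym]) and that nabla_X xi = phi h X
    - phi X ([nabla_xi_eq]). The nullity condition for R(X, xi) xi, compared
    with its conjugate by phi, then gives h^2 = (1 + kappa) (I - eta (x) xi)
    ([h_squared]). So TM is the orthogonal sum of D(l), D(- l) and the line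
    of xi, with smooth projections, and phi, which anticommutes with h,
    exchanges D(l) and D(- l). In particular D(l) has rank n and d eta
    vanishes on it.

    The heart of the matter is that T(X,Y,Z) = g(nabla_X Y, phi Z) vanishes
    for sections X, Y, Z of D(l) ([metric_nabla_eigen]), that is, nabla_X Y
    has no component along D(- l). By the nullity condition R(U,V) xi = 0
    whenever eta U = eta V = 0. On D(l) and D(- l) the operator nabla xi is
    a constant multiple of phi, so these equations are linear in the first
    derivatives of the eigenfields. Taking U, V = X, Y and U, V = X, phi Y
    gives two relations between the values of T at permuted arguments
    ([nabla_eigen_swap] and [nabla_eigen_sym]), and these relations only
    have the solution T = 0 as l is not 0 ([ternary_form_eq0]).

    Since nabla_X Y has no component along xi either, D(l) is totally
    geodesic, and it is integrable because nabla is torsion-free. Finally,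
    for Y in D(- l) and X, Z in D(l), g(nabla_X Y, Z) = - g(Y, nabla_X Z) =
    0, so that nabla_X Y has no component along D(l). Exchanging l and - l
    gives the other half of each statement. *)

Set Implicit Arguments.
Unset Strict Implicit.
Unset Printing Implicit Defensive.

Local Open Scope classical_set_scope.
Local Open Scope ring_scope.

(** * Calculus of smooth functions and vector fields *)

Section Evaluation.
Variables (R : realType) (m : nat) (M : smooth_manifold R m).
Implicit Types (f k : 'C^oo(M)) (X Y Z : vector_field M) (p : M).

Lemma smooth_fun_ext f k : (forall p, f p = k p) -> f = k.
Proof. by move=> fk; apply/val_inj/funext. Qed.

Lemma smooth_fun_eval p f k : f = k -> f p = k p.
Proof. by move=> ->. Qed.

Lemma smooth_addE f k p : (f + k) p = f p + k p. Proof. by []. Qed.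
Lemma smooth_oppE f p : (- f) p = - f p. Proof. by []. Qed.
Lemma smooth_mulE f k p : (f * k) p = f p * k p. Proof. by []. Qed.
Lemma smooth_0E p : (0 : 'C^oo(M)) p = 0. Proof. by []. Qed.
Lemma smooth_1E p : (1 : 'C^oo(M)) p = 1. Proof. by []. Qed.
Lemma smooth_cstE (a : R) p : (a%:S : 'C^oo(M)) p = a. Proof. by []. Qed.

Definition smoothE :=
  (smooth_addE, smooth_oppE, smooth_mulE, smooth_0E, smooth_1E, smooth_cstE).

Lemma vector_field_ext X Y : (forall f, X f = Y f) -> X = Y.
Proof. by move=> XY; apply/val_inj/funext. Qed.

Lemma vector_field_addE X Y f : (X + Y) f = X f + Y f. Proof. by []. Qed.
Lemma vector_field_oppE X f : (- X) f = - X f. Proof. by []. Qed.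
Lemma vector_field_scaleE k X f : (k *: X) f = k * X f. Proof. by []. Qed.
Lemma lie_bracketE X Y f : [< X, Y >] f = X (Y f) - Y (X f). Proof. by []. Qed.

Definition vector_fieldE :=
  (vector_field_addE, vector_field_oppE, vector_field_scaleE, lie_bracketE).

Lemma derivationD X f k : X (f + k) = X f + X k.
Proof. by have := vector_fieldP X; rewrite inE => -[-> _ _]. Qed.

Lemma derivationM X f k : X (f * k) = f * X k + k * X f.
Proof. by have := vector_fieldP X; rewrite inE => -[_ _ ->]. Qed.

Lemma derivation1 X : X 1 = 0.
Proof.
have := derivationM X 1 1; rewrite !mul1r => /eqP.
by rewrite -subr_eq0 opprD addNKr oppr_eq0 => /eqP.
Qed.

Lemma derivation_cst X (a : R) : X a%:S = 0.
Proof.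
have := vector_fieldP X; rewrite inE => -[_ XZ _].
by rewrite -[a%:S]mulr1 XZ derivation1 mulr0.
Qed.

Lemma derivation0 X : X 0 = 0.
Proof.
have /eqP := derivationD X 0 0; rewrite addr0 -subr_eq0 opprD addNKr.
by rewrite oppr_eq0 => /eqP.
Qed.

Lemma derivationN X f : X (- f) = - X f.
Proof.
by apply/eqP; rewrite -addr_eq0 -derivationD addNr derivation0.
Qed.

Lemma value_atD X Y p : value_at (X + Y) p = value_at X p + value_at Y p.
Proof. by []. Qed.

Lemma value_atZ f X p : value_at (f *: X) p = f p *: value_at X p.
Proof. by []. Qed.

Lemma value_at_cstZ (a : R) X p : value_at (a%:S *: X) p = a *: value_at X p.
Proof. by []. Qed.

Lemma value_at_inj X Y : (forall p, value_at X p = value_at Y p) -> X = Y.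
Proof.
move=> XY; apply: vector_field_ext => f; apply: smooth_fun_ext => p.
by have /(congr1 (fun v => v f)) := XY p.
Qed.

Lemma lie_bracketDr X Y Z : [< X, Y + Z >] = [< X, Y >] + [< X, Z >].
Proof.
apply: vector_field_ext => f; rewrite !vector_fieldE derivationD; ring.
Qed.

Lemma lie_bracketZr X f Y : [< X, f *: Y >] = X f *: Y + f *: [< X, Y >].
Proof.
apply: vector_field_ext => k; rewrite !vector_fieldE derivationM; ring.
Qed.

Lemma lie_bracketxx X : [< X, X >] = 0.
Proof. by apply: vector_field_ext => f; rewrite !vector_fieldE subrr. Qed.

Lemma jacobi X Y Z :
  [< X, [< Y, Z >] >] = [< [< X, Y >], Z >] + [< Y, [< X, Z >] >].
Proof.
apply: vector_field_ext => f; rewrite !vector_fieldE !derivationD !derivationN.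
ring.
Qed.

End Evaluation.

(** * A linear system on ternary forms *)

(** For fixed arguments the two relations are six linear equations between
    the six values of [t] at their permutations.  With a = 1 + l and b = 1 - l
    the system is singular only for a^2 - b^2 = 4 l = 0; for instance on
    symmetric forms the second relation reads 2 a t = 2 b t, and on alternating
    forms the first one reads - 2 b t = 2 a t. *)
Lemma ternary_form_eq0 (R : realType) (I : Type) (l : R) (t : I -> I -> I -> R) :
  l != 0 ->
  (forall x y z, (1 - l) * (t x z y - t y z x) = (1 + l) * (t x y z - t y x z)) ->
  (forall x y z, (1 + l) * (t x y z + t z y x) = (1 - l) * (t x z y + t z x y)) ->
  forall x y z, t x y z = 0.
Proof.
move=> l0 E G x y z; apply: (mulfI l0); rewrite mulr0.
pose dE x y z := (1 - l) * (t x z y - t y z x) - (1 + l) * (t x y z - t y x z).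
pose dG x y z := (1 + l) * (t x y z + t z y x) - (1 - l) * (t x z y + t z x y).
have dE0 u v w : dE u v w = 0 by rewrite /dE E subrr.
have dG0 u v w : dG u v w = 0 by rewrite /dG G subrr.
(* A row of the inverse of the six by six system, cleared of its
   denominator a^2 - b^2. *)
have -> : l * t x y z =
    4^-1 * (dE z x y - dE x y z + dG z x y +
            l * (dG x y z - dG y z x - dE y z x)).
  by rewrite /dE /dG; field.
by rewrite !dE0 !dG0 !(subr0, addr0, mulr0).
Qed.

(** * Vector fields tested against the metric *)

Section Metric.
Variables (R : realType) (m : nat) (M : smooth_manifold R m).
Variable g : vector_field M -> vector_field M -> 'C^oo(M).
Hypothesis g_metric : pseudo_riemannian g.
Implicit Types (f : 'C^oo(M)) (X Y Z : vector_field M) (p : M).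

Let gC X Y : g X Y = g Y X. Proof. exact: Defs.metric_sym. Qed.

Lemma metricDr X Y Z : g X (Y + Z) = g X Y + g X Z.
Proof. by have := metric_linear g_metric X 1 Y Z; rewrite !scale1r. Qed.

Lemma metric0r X : g X 0 = 0.
Proof.
have /eqP := metricDr X 0 0; rewrite addr0 -subr_eq0 opprD addNKr.
by rewrite oppr_eq0 => /eqP.
Qed.

Lemma metricZr X f Y : g X (f *: Y) = f * g X Y.
Proof.
by have := metric_linear g_metric X f Y 0; rewrite !addr0 metric0r addr0.
Qed.

Lemma metricNr X Y : g X (- Y) = - g X Y.
Proof. by rewrite -scaleN1r metricZr mulN1r. Qed.

Lemma metricDl X Y Z : g (X + Y) Z = g X Z + g Y Z.
Proof. by rewrite !(gC _ Z) metricDr. Qed.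

Lemma metricZl f X Y : g (f *: X) Y = f * g X Y.
Proof. by rewrite !(gC _ Y) metricZr. Qed.

Lemma metricNl X Y : g (- X) Y = - g X Y.
Proof. by rewrite !(gC _ Y) metricNr. Qed.

Lemma metric0l X : g 0 X = 0.
Proof. by rewrite gC metric0r. Qed.

Definition metricE := (metricDr, metricZr, metricNr, metric0r,
  metricDl, metricZl, metricNl, metric0l).

(** Nondegeneracy makes the metric separate tangent vectors, which turns
    identities between vector fields into identities between numbers. *)
Lemma value_at_metric X Y p :
  value_at X p = value_at Y p <-> forall Z, g X Z p = g Y Z p.
Proof.
have valueB : value_at (X - Y) p = value_at X p - value_at Y p by [].
split=> [XY Z|XY]; last first.
  apply/eqP; rewrite -subr_eq0 -valueB; apply/eqP.
  apply/(metric_nondegenerate g_metric) => Z.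
  by rewrite metricDl metricNl smoothE XY subrr.
have /(metric_nondegenerate g_metric)/(_ Z) : value_at (X - Y) p = 0.
  by rewrite valueB XY subrr.
by rewrite metricDl metricNl smoothE => /eqP; rewrite subr_eq0 => /eqP.
Qed.

Lemma metric_ext X Y : (forall Z, g X Z = g Y Z) -> X = Y.
Proof.
by move=> XY; apply: value_at_inj => p; apply/value_at_metric => Z; rewrite XY.
Qed.

Lemma metric_ext_at X Y : (forall Z p, g X Z p = g Y Z p) -> X = Y.
Proof. by move=> XY; apply: metric_ext => Z; apply: smooth_fun_ext. Qed.

End Metric.

(** * Paracontact metric structures *)

Section TensorH.
Variables (R : realType) (m : nat) (M : smooth_manifold R m).
Variables (phi : {linear vector_field M -> vector_field M}) (xi : vector_field M).

Lemma tensor_h_linear : linear (tensor_h phi xi).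
Proof.
move=> f X Y; rewrite /tensor_h /lie_derivative linearP.
rewrite !lie_bracketDr !lie_bracketZr !linearD !linearZ.
apply: vector_field_ext => k; rewrite !vector_fieldE /=; ring.
Qed.

HB.instance Definition _ := GRing.isLinear.Build 'C^oo(M) (vector_field M)
  (vector_field M) *:%R (tensor_h phi xi) tensor_h_linear.

End TensorH.

Section Paracontact.
Variables (R : realType) (n : nat) (M : smooth_manifold R n.*2.+1).
Variables (phi : {linear vector_field M -> vector_field M}) (xi : vector_field M).
Variable eta : {linear vector_field M -> 'C^oo(M)^o}.
Variable g : vector_field M -> vector_field M -> 'C^oo(M).
Hypothesis Mparacontact : paracontact_metric n phi xi eta g.
Implicit Types (f : 'C^oo(M)) (X Y Z : vector_field M) (p : M).

(** [h] is an abstract copy of [tensor_h phi xi], so that rewriting uses its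
    properties and never expands it into Lie brackets. *)
Variable h : {linear vector_field M -> vector_field M}.
Hypothesis h_tensor : forall X, h X = tensor_h phi xi X.

Let g_metric : pseudo_riemannian g := paracontact_riemannian Mparacontact.
Let gC X Y : g X Y = g Y X. Proof. exact: Defs.metric_sym. Qed.
Let gE := metricE g_metric.
Let phiD X Y : phi (X + Y) = phi X + phi Y. Proof. exact: linearD. Qed.
Let phiN X : phi (- X) = - phi X. Proof. exact: linearN. Qed.
Let phiZ f X : phi (f *: X) = f *: phi X. Proof. exact: linearZ. Qed.
Let etaD X Y : eta (X + Y) = eta X + eta Y :> 'C^oo(M).
Proof. exact: linearD. Qed.
Let etaN X : eta (- X) = - eta X :> 'C^oo(M).
Proof. exact: linearN. Qed.
Let etaZ f X : eta (f *: X) = f * (eta X : 'C^oo(M)) :> 'C^oo(M).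
Proof. by rewrite linearZ. Qed.

Let hD X Y : h (X + Y) = h X + h Y. Proof. exact: linearD. Qed.
Let hN X : h (- X) = - h X. Proof. exact: linearN. Qed.
Let hZ f X : h (f *: X) = f *: h X. Proof. exact: linearZ. Qed.

Let etaxi : eta xi = 1 :> 'C^oo(M) := eta_xi (paracontact_almost Mparacontact).

Let phi2 X : phi (phi X) = X - (eta X : 'C^oo(M)) *: xi :=
  phi_squared (paracontact_almost Mparacontact) X.

(** phi^2 kills xi and phi^3 xi = phi xi - eta(phi xi) xi, so that
    phi xi = f xi with f^2 xi = 0; real functions have no nilpotents. *)
Lemma phi_xi : phi xi = 0.
Proof.
have phi2xi : phi (phi xi) = 0 by rewrite phi2 etaxi scale1r subrr.
have phixi : phi xi = (eta (phi xi) : 'C^oo(M)) *: xi.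
  by apply/eqP; rewrite -subr_eq0 -phi2 phi2xi linear0.
have f2 : (eta (phi xi) : 'C^oo(M)) * (eta (phi xi) : 'C^oo(M)) = 0.
  have := congr1 (fun X => eta X : 'C^oo(M)) phi2xi.
  by rewrite phixi phiZ [in LHS]phixi !etaZ etaxi !mulr1 linear0.
rewrite phixi (_ : (eta (phi xi) : 'C^oo(M)) = 0) ?scale0r //.
apply: smooth_fun_ext => p; have := smooth_fun_eval p f2.
by rewrite smoothE => /eqP; rewrite mulf_eq0 orbb => /eqP.
Qed.

Lemma eta_phi X : eta (phi X) = 0 :> 'C^oo(M).
Proof.
have : (eta (phi X) : 'C^oo(M)) *: xi = 0.
  apply/eqP; rewrite -oppr_eq0 -(inj_eq (addrI (phi X))) addr0 -phi2.
  by rewrite [phi (phi X)]phi2 phiD phiN phiZ phi_xi scaler0 oppr0 addr0.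
move/(congr1 (fun X => eta X : 'C^oo(M))).
by rewrite etaZ etaxi mulr1 linear0.
Qed.

Lemma metric_xi X : g X xi = eta X.
Proof.
have := paracontact_compatible Mparacontact X xi.
rewrite phi_xi gE etaxi mulr1 => /esym/eqP.
by rewrite addrC subr_eq0 => /eqP.
Qed.

Lemma d_eta_metric X Y :
  X (eta Y) - Y (eta X) - eta [< X, Y >] = g X (phi Y) + g X (phi Y).
Proof.
have <- := paracontact_d_eta Mparacontact X Y.
rewrite /exterior_derivative; apply: smooth_fun_ext => p.
by rewrite !smoothE; field.
Qed.

(** As d eta is alternating, so is g(X, phi Y). *)
Lemma metric_phi X Y : g (phi X) Y = - g X (phi Y).
Proof.
rewrite gC -!(paracontact_d_eta Mparacontact) /exterior_derivative.
have -> : [< Y, X >] = - [< X, Y >].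
  by apply: vector_field_ext => f; rewrite !vector_fieldE opprB.
by rewrite etaN; ring.
Qed.

(** The contraction of d eta with xi vanishes, hence L_xi eta = 0. *)
Lemma eta_lie_bracket_xi X : eta [< xi, X >] = xi (eta X) :> 'C^oo(M).
Proof.
have := d_eta_metric xi X.
rewrite [g _ _]gC metric_xi eta_phi etaxi derivation1 subr0 addr0 => /eqP.
by rewrite subr_eq0 => /eqP.
Qed.

Lemma h_xi : h xi = 0.
Proof.
rewrite h_tensor /tensor_h /lie_derivative phi_xi lie_bracketxx linear0 subr0.
have -> : [< xi, 0 >] = 0 :> vector_field M.
  rewrite -[X in [< _, X >]](scale0r 0) lie_bracketZr derivation0.
  by rewrite !scale0r addr0.
by rewrite scaler0.
Qed.

Lemma h_lie X : h X + h X = lie_derivative xi phi X.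
Proof.
rewrite h_tensor /tensor_h -scalerDl -[RHS]scale1r; congr (_ *: _).
by apply: smooth_fun_ext => p; rewrite !smoothE; field.
Qed.

Lemma eta_h X : eta (h X) = 0 :> 'C^oo(M).
Proof.
rewrite h_tensor /tensor_h /lie_derivative etaZ etaD etaN eta_phi.
rewrite eta_lie_bracket_xi.
by rewrite eta_phi derivation0 subr0 mulr0.
Qed.

(** The Lie derivative along xi of phi^2 = I - eta (x) xi vanishes, as those
    of eta and xi do. *)
Lemma h_phi X : h (phi X) = - phi (h X).
Proof.
rewrite !h_tensor /tensor_h /lie_derivative phiZ phiD phiN !phi2.
rewrite -[- (_ *: xi)]scaleNr.
rewrite lie_bracketDr lie_bracketZr lie_bracketxx eta_lie_bracket_xi derivationN.
by apply: (metric_ext_at g_metric) => Z p; rewrite !gE !smoothE; ring.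
Qed.

(** The flow of xi preserves eta, hence also d eta: the Jacobi identity. *)
Lemma lie_xi_d_eta X Y :
  xi (g X (phi Y)) = g [< xi, X >] (phi Y) + g X (phi [< xi, Y >]).
Proof.
suff E : xi (g X (phi Y) + g X (phi Y)) =
    (g [< xi, X >] (phi Y) + g [< xi, X >] (phi Y)) +
    (g X (phi [< xi, Y >]) + g X (phi [< xi, Y >])).
  apply: smooth_fun_ext => p; have := smooth_fun_eval p E.
  rewrite derivationD !smoothE; lra.
rewrite -!d_eta_metric !derivationD !derivationN -!eta_lie_bracket_xi.
rewrite (jacobi xi X Y) etaD !eta_lie_bracket_xi.
rewrite ![[< xi, _ >] _]lie_bracketE; ring.
Qed.

Variable nabla : vector_field M -> vector_field M -> vector_field M.
Hypothesis nabla_LC : levi_civita g nabla.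

Let nablaE X Y : nabla X Y = [< X, Y >] + nabla Y X.
Proof. by rewrite -(nabla_torsion_free nabla_LC) subrK. Qed.

Let nablaN X Y : nabla X (- Y) = - nabla X Y.
Proof.
rewrite -scaleN1r (nablaZr nabla_LC) derivationN derivation1 oppr0 scale0r.
by rewrite add0r scaleN1r.
Qed.

Lemma nabla_cst (a : R) X Y : nabla X (a%:S *: Y) = a%:S *: nabla X Y.
Proof. by rewrite (nablaZr nabla_LC) derivation_cst scale0r add0r. Qed.

Lemma metric_nabla_xi X : g (nabla X xi) xi = 0.
Proof.
have := nabla_metric nabla_LC X xi xi.
rewrite [g xi (nabla _ _)]gC metric_xi etaxi derivation1 => /esym E.
apply: smooth_fun_ext => p; have := smooth_fun_eval p E.
rewrite !smoothE metric_xi; lra.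
Qed.

(** The left-hand side is (L_xi g)(X, phi Y): differentiating the invariant
    form g(X, phi Y) along xi balances the derivative of g against that of
    phi. *)
Lemma lie_metric_phi X Y :
  g (nabla X xi) (phi Y) + g X (nabla (phi Y) xi) = - (g X (h Y) + g X (h Y)).
Proof.
have E := lie_xi_d_eta X Y; rewrite (nabla_metric nabla_LC) !(nablaE xi) !gE in E.
rewrite -(metricDr g_metric) h_lie /lie_derivative.
apply: smooth_fun_ext => p; have := smooth_fun_eval p E.
rewrite !gE !smoothE; lra.
Qed.

(** L_xi g is symmetric; evaluate it on phi X and phi Y by [lie_metric_phi] and
    remove phi with its anticommutation with [h]. *)
Lemma h_sym X Y : g (h X) Y = g X (h Y).
Proof.
have phi_sym U V : g (phi U) (h V) = g (phi V) (h U).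
  have E1 := lie_metric_phi (phi U) V; have E2 := lie_metric_phi (phi V) U.
  apply: smooth_fun_ext => p.
  have := smooth_fun_eval p E1.
  have := smooth_fun_eval p E2.
  rewrite !smoothE ![g (nabla _ _) _]gC; lra.
have := phi_sym (phi X) Y.
rewrite h_phi phi2 !gE [g xi _]gC metric_xi eta_h mulr0 oppr0 addr0.
move=> ->; rewrite gC (paracontact_compatible Mparacontact) eta_h mulr0 addr0.
by rewrite opprK.
Qed.

(** The symmetric part of X |-> nabla_X xi is known from [lie_metric_phi],
    and the skew part from g(X, phi Y) = d eta(X, Y). *)
Lemma nabla_xi_eq X : nabla X xi = phi (h X) - phi X.
Proof.
apply: (metric_ext g_metric) => Z.
have nabla_phi Y : g (nabla X xi) (phi Y) = g X (phi (phi Y)) - g X (h Y).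
  have E1 := lie_metric_phi X Y.
  have E2 := d_eta_metric X (phi Y).
  have E3 := nabla_metric nabla_LC X (phi Y) xi.
  have E4 := nabla_metric nabla_LC (phi Y) X xi.
  rewrite -!metric_xi in E2.
  have E5 := congr1 (g^~ xi) (nablaE X (phi Y)).
  rewrite metricDl // in E5.
  apply: smooth_fun_ext => p.
  have := smooth_fun_eval p E1; have := smooth_fun_eval p E2.
  have := smooth_fun_eval p E3; have := smooth_fun_eval p E4.
  have := smooth_fun_eval p E5; rewrite !smoothE ![g (phi Y) _]gC; lra.
have := nabla_phi (phi Z).
rewrite h_phi [phi (phi Z)]phi2 phiD phiN phiZ phi_xi scaler0 subr0.
rewrite !gE metric_nabla_xi mulr0 subr0 => ->.
by rewrite !metric_phi h_sym h_phi !gE; ring.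
Qed.

Lemma nabla_xi_phi X : nabla xi (phi X) = phi (nabla xi X).
Proof.
rewrite !(nablaE xi) !nabla_xi_eq !phiD !phiN h_phi !phiN !phi2.
rewrite eta_h.
have := h_lie X; rewrite /lie_derivative => E.
have -> : [< xi, phi X >] = h X + h X + phi [< xi, X >] by rewrite E subrK.
by apply: (metric_ext_at g_metric) => Z p; rewrite !gE !smoothE; ring.
Qed.

Variables kappa mu : R.
Hypothesis Mnullity : nullity_condition phi xi eta nabla kappa mu.

(** With A = nabla xi, the curvature gives R(Y, xi) xi = h^2 Y - phi^2 Y -
    phi (nabla_xi h) Y. Conjugation by phi changes the sign of the terms in
    h and in phi (nabla_xi h), so that adding the conjugate equation
    eliminates mu and nabla_xi h. *)
Lemma h_squared X :
  h (h X) = (1 + kappa)%:S *: (X - (eta X : 'C^oo(M)) *: xi).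
Proof.
(* The last parenthesis is phi (nabla_xi h) Y. *)
have jacobi_operator Y :
    kappa%:S *: (Y - (eta Y : 'C^oo(M)) *: xi) + mu%:S *: h Y =
    h (h Y) - (Y - (eta Y : 'C^oo(M)) *: xi) -
    (phi (nabla xi (h Y)) - phi (h (nabla xi Y))).
  have := Mnullity Y xi; rewrite -!h_tensor h_xi scaler0 subr0 etaxi.
  rewrite !scale1r => <-.
  rewrite /curvature !nabla_xi_eq h_xi phi_xi linear0 subrr.
  have nabla0 V : nabla V 0 = 0.
    rewrite -[0 in LHS](scale0r 0) (nablaZr nabla_LC) derivation0.
    by rewrite !scale0r addr0.
  rewrite nabla0 (nablaDr nabla_LC) nablaN !nabla_xi_phi.
  have -> : [< Y, xi >] = phi (h Y) - phi Y - nabla xi Y.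
    by rewrite -nabla_xi_eq -(nabla_torsion_free nabla_LC).
  rewrite !(hD, hN, h_phi, phiD, phiN, phi2, eta_phi, eta_h, etaD, etaN).
  by apply: (metric_ext_at g_metric) => Z p; rewrite !gE !smoothE; ring.
have := congr1 phi (jacobi_operator (phi X)).
have := jacobi_operator X.
rewrite !(hD, hN, h_phi, nablaN, nabla_xi_phi, phiD, phiN, phiZ, phi2).
rewrite !(eta_phi, eta_h, etaD, etaN, phi_xi).
move=> E1 E2; apply: (metric_ext_at g_metric) => Z p.
have := congr1 (fun V => g V Z p) E1; have := congr1 (fun V => g V Z p) E2.
rewrite !gE !smoothE; lra.
Qed.

(** * Covariant derivatives of eigenfields *)

Variable l : R.
Hypothesis l_neq0 : l != 0.
Hypothesis l2 : l * l = 1 + kappa.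

Lemma eta_eigen a X : a != 0 -> h X = a%:S *: X -> eta X = 0 :> 'C^oo(M).
Proof.
move=> a0 eX; apply: smooth_fun_ext => p; apply: (mulfI a0).
by have := smooth_fun_eval p (eta_h X); rewrite eX etaZ !smoothE mulr0.
Qed.

Lemma eigen_phi a X : h X = a%:S *: X -> h (phi X) = (- a)%:S *: phi X.
Proof.
move=> eX; rewrite h_phi eX phiZ -scaleNr; congr (_ *: _).
by apply: smooth_fun_ext => p; rewrite !smoothE.
Qed.

Lemma metric_eigen a X Y : a != 0 -> h X = a%:S *: X -> h Y = (- a)%:S *: Y ->
  g X Y = 0.
Proof.
move=> a0 eX eY; apply: smooth_fun_ext => p; apply: (mulfI a0).
have := smooth_fun_eval p (h_sym X Y).
rewrite eX eY !gE !smoothE; lra.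
Qed.

Lemma nabla_xi_eigen a X : h X = a%:S *: X -> nabla X xi = (a - 1)%:S *: phi X.
Proof.
move=> eX; rewrite nabla_xi_eq eX phiZ.
by apply: (metric_ext_at g_metric) => Z p; rewrite !gE !smoothE; ring.
Qed.

Lemma curvature_xi_eq0 X Y : eta X = 0 :> 'C^oo(M) -> eta Y = 0 :> 'C^oo(M) ->
  nabla X (nabla Y xi) - nabla Y (nabla X xi) = nabla [< X, Y >] xi.
Proof.
move=> etaX etaY; apply/eqP; rewrite -subr_eq0; apply/eqP.
have := Mnullity X Y; rewrite /curvature => ->.
by rewrite etaX etaY !scale0r !subr0 !scaler0 addr0.
Qed.

Let gnabla a X Y Z : a != 0 -> h Y = a%:S *: Y -> h Z = a%:S *: Z ->
  g (nabla X (phi Z)) Y = - g (nabla X Y) (phi Z).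
Proof.
move=> a0 eY eZ; have := nabla_metric nabla_LC X Y (phi Z).
rewrite (metric_eigen a0 eY (eigen_phi eZ)) derivation0 [g Y _]gC => /esym/eqP.
by rewrite addrC addr_eq0 => /eqP.
Qed.

Lemma metric_nabla_xi_eigen a V Z : h Z = a%:S *: Z ->
  g (nabla V xi) Z = (1 + a)%:S * g V (phi Z).
Proof.
move=> eZ; rewrite nabla_xi_eq !gE !metric_phi h_sym (eigen_phi eZ) !gE.
by apply: smooth_fun_ext => p; rewrite !smoothE; ring.
Qed.

(** The Codazzi-type equation R(X,Y) xi = 0 paired with Z: since nabla xi
    maps the l-eigenfield Y to (l - 1) phi Y, it only involves the values of
    T(X,Y,Z) = g(nabla_X Y, phi Z). *)
Lemma nabla_eigen_swap X Y Z p :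
  h X = l%:S *: X -> h Y = l%:S *: Y -> h Z = l%:S *: Z ->
  (1 - l) * (g (nabla X Z) (phi Y) p - g (nabla Y Z) (phi X) p) =
  (1 + l) * (g (nabla X Y) (phi Z) p - g (nabla Y X) (phi Z) p).
Proof.
move=> eX eY eZ.
have := curvature_xi_eq0 (eta_eigen l_neq0 eX) (eta_eigen l_neq0 eY).
rewrite (nabla_xi_eigen eX) (nabla_xi_eigen eY) !nabla_cst => /(congr1 (g^~ Z)).
rewrite (metric_nabla_xi_eigen _ eZ) -(nabla_torsion_free nabla_LC) !gE.
rewrite (gnabla _ l_neq0 eZ eY) (gnabla _ l_neq0 eZ eX) => /(smooth_fun_eval p).
by rewrite !smoothE; lra.
Qed.

(** Now R(X, phi Y) xi = 0 is paired with phi Z. Besides the values of T, it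
    contains the term w(X,Z), which measures the covariant derivative of phi
    along phi Y and is skew in X and Z; symmetrizing in X and Z removes it. *)
Lemma nabla_eigen_sym X Y Z p :
  h X = l%:S *: X -> h Y = l%:S *: Y -> h Z = l%:S *: Z ->
  (1 + l) * (g (nabla X Y) (phi Z) p + g (nabla Z Y) (phi X) p) =
  (1 - l) * (g (nabla X Z) (phi Y) p + g (nabla Z X) (phi Y) p).
Proof.
move=> eX eY eZ.
pose w U V := g (nabla (phi Y) (phi U)) (phi V) + g (nabla (phi Y) U) V.
have F U V : h U = l%:S *: U -> h V = l%:S *: V ->
    (1 + l) * g (nabla U Y) (phi V) p =
    (1 - l) * (g (nabla U V) (phi Y) p + w U V p).
  move=> eU eV.
  have := curvature_xi_eq0 (eta_eigen l_neq0 eU) (eta_phi Y).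
  have phi2K W : h W = l%:S *: W -> phi (phi W) = W.
    by move=> eW; rewrite phi2 (eta_eigen l_neq0 eW) scale0r subr0.
  rewrite (nabla_xi_eigen eU) (nabla_xi_eigen (eigen_phi eY)) !nabla_cst.
  move/(congr1 (g^~ (phi V))).
  rewrite (metric_nabla_xi_eigen _ (eigen_phi eV)).
  rewrite -(nabla_torsion_free nabla_LC) !gE.
  rewrite !phi2K // (gnabla _ l_neq0 eV eY) => /(smooth_fun_eval p).
  by rewrite /w !smoothE; lra.
have w_skew : w X Z p + w Z X p = 0.
  have := nabla_metric nabla_LC (phi Y) (phi X) (phi Z).
  rewrite (paracontact_compatible Mparacontact) (eta_eigen l_neq0 eX) mul0r addr0.
  rewrite derivationN (nabla_metric nabla_LC) => /(smooth_fun_eval p).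
  by rewrite /w !smoothE [g X _]gC [g (phi X) _]gC; lra.
have := F X Z eX eZ; have := F Z X eZ eX; move: w_skew.
set u := w X Z p; set v := w Z X p => uv.
have -> : v = - u by lra.
by lra.
Qed.

Lemma metric_nabla_eigen X Y Z :
  h X = l%:S *: X -> h Y = l%:S *: Y -> h Z = l%:S *: Z ->
  g (nabla X Y) (phi Z) = 0.
Proof.
move=> eX eY eZ; apply: smooth_fun_ext => p.
pose t (U V W : {U | h U = l%:S *: U}) :=
  g (nabla (sval U) (sval V)) (phi (sval W)) p.
apply: (@ternary_form_eq0 _ _ l t l_neq0 _ _
  (exist _ X eX) (exist _ Y eY) (exist _ Z eZ)).
  by move=> [U eU] [V eV] [W eW]; exact: nabla_eigen_swap.
by move=> [U eU] [V eV] [W eW]; exact: nabla_eigen_sym.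
Qed.

(** For a^2 = 1 + kappa, the projection of TM onto the a-eigendistribution
    along the (-a)-eigendistribution and xi. *)
Definition eigen_proj a X :=
  (2^-1)%:S *: (X - (eta X : 'C^oo(M)) *: xi + (a^-1)%:S *: h X).

Lemma eigen_proj_sym a X Y : g (eigen_proj a X) Y = g X (eigen_proj a Y).
Proof.
by rewrite /eigen_proj !gE h_sym [g xi _]gC !metric_xi; ring.
Qed.

Lemma eigen_eigen_proj a X : a != 0 -> a * a = 1 + kappa ->
  h (eigen_proj a X) = a%:S *: eigen_proj a X.
Proof.
move=> a0 a2; rewrite /eigen_proj hZ !hD hN !hZ h_xi h_squared -a2.
by apply: (metric_ext_at g_metric) => Z p; rewrite !gE !smoothE; field.
Qed.

Lemma eigen_proj_decomp X :
  X = eigen_proj l X + eigen_proj (- l) X + (eta X : 'C^oo(M)) *: xi.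
Proof.
apply: (metric_ext_at g_metric) => Z p; rewrite /eigen_proj !gE !smoothE.
by field.
Qed.

Lemma eigen_projD a X Y : eigen_proj a (X + Y) = eigen_proj a X + eigen_proj a Y.
Proof.
rewrite /eigen_proj etaD hD.
by apply: (metric_ext_at g_metric) => Z p; rewrite !gE !smoothE; ring.
Qed.

Lemma eigen_proj_id X : h X = l%:S *: X -> eigen_proj l X = X.
Proof.
move=> eX; rewrite /eigen_proj (eta_eigen l_neq0 eX) eX.
by apply: (metric_ext_at g_metric) => Z p; rewrite !gE !smoothE; field.
Qed.

Lemma eigen_proj_opp X : h X = (- l)%:S *: X -> eigen_proj l X = 0.
Proof.
move=> eX; rewrite /eigen_proj (eta_eigen _ eX) ?oppr_eq0 // eX.
by apply: (metric_ext_at g_metric) => Z p; rewrite !gE !smoothE; field.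
Qed.

Lemma eigen_proj_xi f : eigen_proj l (f *: xi) = 0.
Proof.
rewrite /eigen_proj etaZ etaxi hZ h_xi.
by apply: (metric_ext_at g_metric) => Z p; rewrite !gE !smoothE; ring.
Qed.

(** The component of nabla_X Y along xi is - g(Y, nabla_X xi), a multiple of
    g(Y, phi X) = 0, and the one in the opposite eigendistribution, the
    image of the l-eigendistribution by phi, is measured by
    [metric_nabla_eigen]. *)
Lemma nabla_eigen X Y : h X = l%:S *: X -> h Y = l%:S *: Y ->
  h (nabla X Y) = l%:S *: nabla X Y.
Proof.
move=> eX eY.
have eta0 : eta (nabla X Y) = 0 :> 'C^oo(M).
  have := nabla_metric nabla_LC X Y xi.
  rewrite !metric_xi (eta_eigen l_neq0 eY) derivation0 (nabla_xi_eigen eX) !gE.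
  by rewrite (metric_eigen l_neq0 eY (eigen_phi eX)) mulr0 addr0.
have opp0 : eigen_proj (- l) (nabla X Y) = 0.
  apply: (metric_ext g_metric) => Z; rewrite eigen_proj_sym (metric0l g_metric).
  have := @eigen_eigen_proj (- l) Z; rewrite oppr_eq0 mulrNN.
  move=> /(_ l_neq0 l2) eZ'.
  have := eigen_phi eZ'; rewrite opprK => /(metric_nabla_eigen eX eY).
  by rewrite phi2 (eta_eigen _ eZ') ?oppr_eq0 // scale0r subr0.
rewrite [nabla X Y]eigen_proj_decomp eta0 opp0 scale0r !addr0.
exact: eigen_eigen_proj.
Qed.

(** For every l-eigenfield Z, g(nabla_X Y, Z) = - g(Y, nabla_X Z), where
    nabla_X Z is again an l-eigenfield and thus orthogonal to Y. *)
Lemma eigen_proj_nabla X Y : h X = l%:S *: X -> h Y = (- l)%:S *: Y ->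
  eigen_proj l (nabla X Y) = 0.
Proof.
move=> eX eY; apply: (metric_ext g_metric) => Z.
rewrite eigen_proj_sym (metric0l g_metric).
have eP := eigen_eigen_proj Z l_neq0 l2.
have := nabla_metric nabla_LC X Y (eigen_proj l Z).
rewrite [g Y (eigen_proj _ _)]gC [g Y (nabla _ _)]gC.
rewrite (metric_eigen l_neq0 eP eY) (metric_eigen l_neq0 (nabla_eigen eX eP) eY).
by rewrite derivation0 addr0.
Qed.

(** * Eigendistributions *)

Definition tensorial (T : vector_field M -> vector_field M) := forall X Y p,
  value_at X p = value_at Y p -> value_at (T X) p = value_at (T Y) p.

Lemma phi_tensorial : tensorial phi.
Proof.
move=> X Y p /(value_at_metric g_metric) XY.
by apply/(value_at_metric g_metric) => Z; rewrite !metric_phi !smoothE XY.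
Qed.

Lemma h_tensorial : tensorial h.
Proof.
move=> X Y p /(value_at_metric g_metric) XY.
by apply/(value_at_metric g_metric) => Z; rewrite !h_sym XY.
Qed.

Lemma eta_tensorial X Y p : value_at X p = value_at Y p ->
  (eta X : 'C^oo(M)) p = (eta Y : 'C^oo(M)) p.
Proof. by move=> /(value_at_metric g_metric) XY; rewrite -!metric_xi XY. Qed.

Lemma eigendistributionP T a X p : tensorial T ->
  eigendistribution T a p (value_at X p) <-> value_at (T X) p = a *: value_at X p.
Proof.
move=> T_tensorial; split=> [[Y /= TY YX]|TX]; last by exists X.
by rewrite -YX -TY; exact/esym/T_tensorial.
Qed.

Lemma kernel_distributionP X p :
  kernel_distribution eta p (value_at X p) <-> (eta X : 'C^oo(M)) p = 0.
Proof.
split=> [[Y /= Y0 YX]|X0]; last by exists X.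
by rewrite -Y0; exact/esym/eta_tensorial.
Qed.

Lemma sections_eigendistribution T a X : tensorial T ->
  sections (eigendistribution T a) X <-> T X = a%:S *: X.
Proof.
move=> T_tensorial; split=> [sX|TX p].
  by apply: value_at_inj => p; have /eigendistributionP -> := sX p.
by apply/eigendistributionP => //; rewrite TX.
Qed.

Lemma value_at_sum (I : finType) (F : I -> vector_field M) p :
  value_at (\sum_i F i) p = \sum_i value_at (F i) p.
Proof. by elim/big_rec2: _ => // i X v _ <-. Qed.

Let eta_eigen_at X p : value_at (h X) p = l *: value_at X p ->
  (eta X : 'C^oo(M)) p = 0.
Proof.
rewrite -value_at_cstZ => /eta_tensorial; rewrite eta_h etaZ !smoothE.
by move=> /esym/eqP; rewrite mulf_eq0 (negbTE l_neq0) => /eqP.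
Qed.

(** On the l-eigendistribution X |-> (X + phi X) / 2 is an isomorphism onto
    the eigendistribution of phi for 1 in ker eta, because phi maps the
    l-eigendistribution to the opposite one; [lift] is its inverse. This
    gives the rank without any dimension count in TM. *)
Let lift X := X + (l^-1)%:S *: h X.

Let lift_eigen X p : (eta X : 'C^oo(M)) p = 0 ->
  value_at (h (lift X)) p = l *: value_at (lift X) p.
Proof.
move=> eta0; rewrite -value_at_cstZ.
apply/(value_at_metric g_metric) => Z.
by rewrite /lift hD hZ h_squared -l2 !gE !smoothE eta0; field.
Qed.

(** At p, [phi] fixes X, so that it sends lift X = X + h X / l to X - h X / l:
    lift X and its image by [phi] add up to 2 X. *)
Let lift_inj X p : value_at (phi X) p = value_at X p ->
  value_at (lift X) p = 0 -> value_at X p = 0.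
Proof.
rewrite -[0]/(value_at 0 p) => phiX lift0.
have phi_lift0 := phi_tensorial lift0; have h_phiX := h_tensorial phiX.
move: lift0 phi_lift0 phiX h_phiX; rewrite /lift h_phi linear0 phiD phiZ.
move=> /(value_at_metric g_metric) E1 /(value_at_metric g_metric) E2.
move=> /(value_at_metric g_metric) E3 /(value_at_metric g_metric) E4.
apply/(value_at_metric g_metric) => Z.
move: (E1 Z) (E2 Z) (E3 Z) (E4 Z); rewrite !gE !smoothE => {}E1 {}E2 {}E3 E4'.
by rewrite -E3 -E4' in E1 E2 *; lra.
Qed.

Let lift_surj X p : value_at (h X) p = l *: value_at X p ->
  value_at (lift ((2^-1)%:S *: (X + phi X))) p = value_at X p.
Proof.
rewrite -value_at_cstZ => eX; have phi_eX := phi_tensorial eX.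
move: eX phi_eX; rewrite phiZ.
move=> /(value_at_metric g_metric) E1 /(value_at_metric g_metric) E2.
apply/(value_at_metric g_metric) => Z; rewrite /lift hZ hD h_phi.
move: (E1 Z) (E2 Z); rewrite !gE !smoothE => -> ->.
by field.
Qed.

Lemma subbundle_eigendistribution : subbundle n (eigendistribution h l).
Proof.
move=> p; split; last first.
  move=> v [X /= eX <-]; have etaX := eta_eigen_at eX.
  exists (eigen_proj l X).
    apply/(sections_eigendistribution _ _ h_tensorial).
    exact: eigen_eigen_proj.
  apply/(value_at_metric g_metric) => Z.
  move: eX; rewrite -value_at_cstZ => /(value_at_metric g_metric)/(_ Z).
  by rewrite /eigen_proj !gE !smoothE => ->; rewrite etaX; field.
have [e [e_free e_span]] := phi_rank_pos (paracontact_almost Mparacontact) p.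
have e_in i : (kernel_distribution eta p `&` eigendistribution phi 1 p) (e i).
  rewrite e_span; exists (fun j => (i == j)%:R) => //.
  rewrite (bigD1 i) //= eqxx scale1r big1 ?addr0 // => j.
  by rewrite eq_sym => /negbTE ->; rewrite scale0r.
have /choice[E E_val] : forall i, exists X, value_at X p = e i.
  by move=> i; have [[X _ <-] _] := e_in i; exists X.
pose comb (c : 'I_n -> R) := \sum_i (c i)%:S *: E i.
have comb_val c : value_at (comb c) p = \sum_i c i *: e i.
  by rewrite value_at_sum; apply: eq_bigr => i _; rewrite value_at_cstZ E_val.
have comb_in c : (kernel_distribution eta p `&` eigendistribution phi 1 p)
    (value_at (comb c) p).
  by rewrite comb_val e_span; exists c.
have comb_eta c : (eta (comb c) : 'C^oo(M)) p = 0.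
  by have [/kernel_distributionP] := comb_in c.
have comb_phi c : value_at (phi (comb c)) p = value_at (comb c) p.
  have [_ /(eigendistributionP _ _ _ phi_tensorial) ->] := comb_in c.
  by rewrite scale1r.
have lift_comb c :
    \sum_i c i *: value_at (lift (E i)) p = value_at (lift (comb c)) p.
  rewrite /lift /comb linear_sum scaler_sumr -big_split value_at_sum.
  apply: eq_bigr => i _; rewrite -value_at_cstZ; congr (value_at _ p).
  by rewrite hZ scalerDr !scalerA mulrC.
exists (fun i => value_at (lift (E i)) p); split=> [c|].
  rewrite lift_comb => /(lift_inj (comb_phi c)); rewrite comb_val.
  exact: e_free.
apply/seteqP; split=> [v [X /= eX <-]|v [c _ <-]]; last first.
  rewrite lift_comb; apply/(eigendistributionP _ _ _ h_tensorial).
  exact: lift_eigen.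
pose W := (2^-1)%:S *: (X + phi X).
have [c _ cW] : [set \sum_i c i *: e i | c in [set: 'I_n -> R]] (value_at W p).
  have etaX := eta_eigen_at eX.
  rewrite -e_span; split.
    by apply/kernel_distributionP; rewrite etaZ etaD eta_phi !smoothE etaX; ring.
  apply/(eigendistributionP _ _ _ phi_tensorial); rewrite scale1r.
  apply/(value_at_metric g_metric) => Z.
  by rewrite phiZ phiD phi2 !gE !smoothE etaX; ring.
exists c => //; rewrite lift_comb -(lift_surj eX) /lift.
have GW : value_at (comb c) p = value_at W p by rewrite comb_val.
by rewrite !value_atD !value_atZ GW (h_tensorial GW).
Qed.

Lemma totally_geodesic_eigendistribution :
  totally_geodesic nabla (eigendistribution h l).
Proof.
move=> X Y /(sections_eigendistribution _ _ h_tensorial) eX.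
move=> /(sections_eigendistribution _ _ h_tensorial) eY.
by apply/(sections_eigendistribution _ _ h_tensorial)/nabla_eigen.
Qed.

Lemma integrable_eigendistribution :
  integrable_distribution (eigendistribution h l).
Proof.
move=> X Y sX sY; rewrite -(nabla_torsion_free nabla_LC).
have /(sections_eigendistribution _ _ h_tensorial) XY :=
  totally_geodesic_eigendistribution sX sY.
have /(sections_eigendistribution _ _ h_tensorial) YX :=
  totally_geodesic_eigendistribution sY sX.
apply/(sections_eigendistribution _ _ h_tensorial).
by rewrite hD hN XY YX scalerBr.
Qed.

Lemma legendre_eigendistribution :
  legendre_foliation n eta (eigendistribution h l).
Proof.
split; first exact: subbundle_eigendistribution.
- move=> p v [X /= eX <-]; apply/kernel_distributionP.
  exact: eta_eigen_at eX.
- exact: integrable_eigendistribution.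
move=> X Y /(sections_eigendistribution _ _ h_tensorial) eX.
move=> /(sections_eigendistribution _ _ h_tensorial) eY.
rewrite (paracontact_d_eta Mparacontact).
by rewrite (metric_eigen l_neq0 eX (eigen_phi eY)).
Qed.

(** In any decomposition Z = A + B + f xi the first component is
    A = eigen_proj l Z. *)
Lemma no_component_eigen_proj Z : eigen_proj l Z = 0 ->
  no_component (eigendistribution h l) (eigendistribution h (- l)) xi Z.
Proof.
move=> Z0; apply/seteqP; split=> A /=.
  move=> [/(sections_eigendistribution _ _ h_tensorial) eA [B [f [sB ZABf]]]].
  have /(sections_eigendistribution _ _ h_tensorial) eB := sB.
  have := Z0; rewrite ZABf !eigen_projD eigen_proj_xi (eigen_proj_opp eB).
  by rewrite (eigen_proj_id eA) !addr0.
move=> ->; split.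
  by apply/(sections_eigendistribution _ _ h_tensorial); rewrite linear0 scaler0.
exists (eigen_proj (- l) Z), (eta Z); split; last first.
  by rewrite -Z0; exact: eigen_proj_decomp.
apply/(sections_eigendistribution _ _ h_tensorial)/eigen_eigen_proj.
  by rewrite oppr_eq0.
by rewrite mulrNN.
Qed.

Lemma no_component_nabla X Y :
  sections (eigendistribution h l) X -> sections (eigendistribution h (- l)) Y ->
  no_component (eigendistribution h l) (eigendistribution h (- l)) xi (nabla X Y).
Proof.
move=> /(sections_eigendistribution _ _ h_tensorial) eX.
move=> /(sections_eigendistribution _ _ h_tensorial) eY.
exact/no_component_eigen_proj/eigen_proj_nabla.
Qed.

End Paracontact.

Theorem theorem4p1 (R : realType) (n : nat) (M : smooth_manifold R n.*2.+1)
  (phi : {linear vector_field M -> vector_field M}) (xi : vector_field M)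
  (eta : {linear vector_field M -> 'C^oo(M)^o})
  (g : vector_field M -> vector_field M -> 'C^oo(M))
  (nabla : vector_field M -> vector_field M -> vector_field M)
  (kappa mu : R)
  (Mparacontact : paracontact_metric n phi xi eta g)
  (nablaLC : levi_civita g nabla)
  (Mnullity : nullity_condition phi xi eta nabla kappa mu)
  (kappa_gt : -1 < kappa) :
  let lambda := Num.sqrt (1 + kappa) in
  let Dpos := eigendistribution (tensor_h phi xi) lambda in
  let Dneg := eigendistribution (tensor_h phi xi) (- lambda) in
  (exists k, forall p, has_index g Dpos p k) ->
  (exists k, forall p, has_index g Dneg p k) ->
  [/\ integrable_distribution Dpos /\ integrable_distribution Dneg,
      legendre_foliation n eta Dpos /\ totally_geodesic nabla Dpos,
      legendre_foliation n eta Dneg /\ totally_geodesic nabla Dneg &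
      forall X Y, sections Dpos X -> sections Dneg Y ->
        no_component Dpos Dneg xi (nabla X Y) /\
        no_component Dneg Dpos xi (nabla Y X)].
Proof.
move=> lambda Dpos Dneg _ _.
have k1 : 0 < 1 + kappa by lra.
have l0 : lambda != 0 by rewrite gt_eqF // sqrtr_gt0.
have nl0 : - lambda != 0 by rewrite oppr_eq0.
have l2 : lambda * lambda = 1 + kappa by rewrite -expr2 sqr_sqrtr // ltW.
have nl2 : (- lambda) * (- lambda) = 1 + kappa by rewrite mulrNN.
pose h : {linear vector_field M -> vector_field M} := tensor_h phi xi.
have hE X : h X = tensor_h phi xi X by [].
split; first split.
- exact: (integrable_eigendistribution Mparacontact hE nablaLC Mnullity l0 l2).
- exact: (integrable_eigendistribution Mparacontact hE nablaLC Mnullity nl0 nl2).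
- split.
    exact: (legendre_eigendistribution Mparacontact hE nablaLC Mnullity l0 l2).
  exact: (totally_geodesic_eigendistribution Mparacontact hE nablaLC
    Mnullity l0 l2).
- split.
    exact: (legendre_eigendistribution Mparacontact hE nablaLC Mnullity nl0 nl2).
  exact: (totally_geodesic_eigendistribution Mparacontact hE nablaLC
    Mnullity nl0 nl2).
move=> X Y sX sY; split.
  exact: (no_component_nabla Mparacontact hE nablaLC Mnullity l0 l2 sX sY).
have nc := no_component_nabla Mparacontact hE nablaLC Mnullity nl0 nl2.
by have := nc Y X; rewrite opprK; apply.
Qed.
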